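(* Let $m, n \geq 1$ be two fixed integers, let $R$ be a $6mn(m+n)(2n+m)$-torsion free semiprime ring, and let $T: R\to R$ be a nonzero generalized $(m,n)$-Jordan centralizer. Then $T$ is a two-sided centralizer.
   Context: $R$ is an associative ring. For an integer $k\geq 2$, $R$ is $k$-torsion free if $kx=0$ implies $x=0$ for all $x\in R$. $R$ is semiprime if $aRa=\{0\}$ implies $a=0$. An additive map $T:R\to R$ is a left (resp. right) centralizer if $T(xy)=T(x)y$ (resp. $T(xy)=xT(y)$) for all $x,y\in R$, and a two-sided centralizer if it is both a left and a right centralizer. For fixed integers $m,n\geq 0$ with $m+n\neq 0$, an additive map $T_0:R\to R$ is an $(m,n)$-Jordan centralizer if $(m+n)T_0(x^2)=mT_0(x)x+nxT_0(x)$ for all $x\in R$; an additive map $T:R\to R$ is a generalized $(m,n)$-Jordan centralizer if there exists an $(m,n)$-Jordan centralizer $T_0:R\to R$ such that $(m+n)T(x^2)=mT(x)x+nxT_0(x)$ for all $x\in R$. *)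

(* Defs.v *)
(* Rings are associative but not assumed unital: a ring is an
   additive abelian group (zmodType) with an explicit associative,
   biadditive multiplication [mul]. *)
From mathcomp Require Import all_boot all_algebra.
Set Implicit Arguments. Unset Strict Implicit. Unset Printing Implicit Defensive.
Import GRing.Theory.
Local Open Scope ring_scope.

Section NonUnitalRing.
Variables (R : zmodType) (mul : R -> R -> R).

Definition assoc_ring_axioms : Prop :=
  [/\ forall x y z, mul x (mul y z) = mul (mul x y) z,
      forall x y z, mul (x + y) z = mul x z + mul y z
    & forall x y z, mul x (y + z) = mul x y + mul x z].

Definition additive_map (T : R -> R) : Prop :=
  forall x y, T (x + y) = T x + T y.

Definition torsion_free (k : nat) : Prop :=
  forall x : R, x *+ k = 0 -> x = 0.

Definition semiprime : Prop :=
  forall a : R, (forall r : R, mul (mul a r) a = 0) -> a = 0.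

Definition left_centralizer (T : R -> R) : Prop :=
  additive_map T /\ forall x y, T (mul x y) = mul (T x) y.

Definition right_centralizer (T : R -> R) : Prop :=
  additive_map T /\ forall x y, T (mul x y) = mul x (T y).

Definition two_sided_centralizer (T : R -> R) : Prop :=
  left_centralizer T /\ right_centralizer T.

Definition mn_jordan_centralizer (m n : nat) (T0 : R -> R) : Prop :=
  additive_map T0 /\
  forall x, T0 (mul x x) *+ (m + n) = mul (T0 x) x *+ m + mul x (T0 x) *+ n.

Definition generalized_mn_jordan_centralizer (m n : nat) (T : R -> R) : Prop :=
  additive_map T /\
  exists T0 : R -> R, mn_jordan_centralizer m n T0 /\
    forall x, T (mul x x) *+ (m + n) = mul (T x) x *+ m + mul x (T0 x) *+ n.

End NonUnitalRing.

(* Main.v *)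
(* With D = T - T0 one has (m+n) D(x^2) = m D(x) x. Evaluating D at x^4 and at
   x^2 y x^2 in two ways gives, after repeated use of semiprimeness,
   D(x) R x^3 = 0 for all x. Linearizing, D(z) R x^3 = 0 for all x and z, and
   D(z) = 0 because an ideal in which all cubes vanish is zero.

   For T0, evaluating at x^4 in two ways, linearizing and substituting
   x y + y x for y eliminates T0(y). The result is an identity relating
   F = [T0(x), x], G = [F, x] and a free y, to be read as a polynomial in the
   commuting operators "multiply by x on the left of F", "on the right of F"
   and "on the right of y". Elimination between its instances on G y G shows
   x^k G = 0, hence G R x^3 = 0, and then F R x^3 = 0. As before F = 0, so T0 is
   a left and right Jordan centralizer, and Zalar's argument applies. *)
Require Import Defs.
From mathcomp Require Import all_boot all_algebra.
From mathcomp Require Import ring.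
Set Implicit Arguments. Unset Strict Implicit. Unset Printing Implicit Defensive.
Import GRing.Theory.
Local Open Scope ring_scope.

(** * Normalization in rings without unit *)

Inductive nexp : Type :=
  | NZero | NVar of nat | NAdd of nexp & nexp | NOpp of nexp
  | NMul of nexp & nexp | NScale of int & nexp.

(** Comparison and concatenation get their own names so that [nring_pre] can unfold exactly these
    and leave the integer coefficients symbolic. *)
Fixpoint nat_cmp (i j : nat) : comparison :=
  match i, j with
  | 0, 0 => Eq | 0, _.+1 => Lt | _.+1, 0 => Gt | i'.+1, j'.+1 => nat_cmp i' j'
  end.

Fixpoint word_cmp (u v : seq nat) : comparison :=
  match u, v with
  | [::], [::] => Eq | [::], _ :: _ => Lt | _ :: _, [::] => Gt
  | i :: u', j :: v' =>
      match nat_cmp i j with Eq => word_cmp u' v' | c => c end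
  end.

Fixpoint word_cat (u v : seq nat) : seq nat :=
  if u is i :: u' then i :: word_cat u' v else v.

(* A coefficient, the first letter and the remaining letters: without a unit
   there is no empty word. *)
Definition nmono : Type := (int * (nat * seq nat))%type.

Fixpoint npoly_insert (t : nmono) (p : seq nmono) : seq nmono :=
  if p is t' :: p' then
    match word_cmp (t.2.1 :: t.2.2) (t'.2.1 :: t'.2.2) with
    | Eq => (t.1 + t'.1, t'.2) :: p'
    | Lt => t :: p
    | Gt => t' :: npoly_insert t p'
    end
  else [:: t].

Fixpoint npoly_add (p q : seq nmono) : seq nmono :=
  if p is t :: p' then npoly_insert t (npoly_add p' q) else q.

Fixpoint npoly_scale (c : int) (p : seq nmono) : seq nmono :=
  if p is t :: p' then (c * t.1, t.2) :: npoly_scale c p' else [::].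

Fixpoint npoly_lmul (t : nmono) (p : seq nmono) : seq nmono :=
  if p is t' :: p' then
    (t.1 * t'.1, (t.2.1, word_cat t.2.2 (t'.2.1 :: t'.2.2))) :: npoly_lmul t p'
  else [::].

Fixpoint npoly_mul (p q : seq nmono) : seq nmono :=
  if p is t :: p' then npoly_add (npoly_lmul t q) (npoly_mul p' q) else [::].

Fixpoint npoly_of (e : nexp) : seq nmono :=
  match e with
  | NZero => [::]
  | NVar i => [:: (1, (i, [::]))]
  | NAdd a b => npoly_add (npoly_of a) (npoly_of b)
  | NOpp a => npoly_scale (-1) (npoly_of a)
  | NMul a b => npoly_mul (npoly_of a) (npoly_of b)
  | NScale c a => npoly_scale c (npoly_of a)
  end.

(** A conjunction rather than a boolean test: the coefficients are polynomials in integer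
    parameters, and [ring] proves each of them zero. *)
Fixpoint ncoefs_zero (p : seq nmono) : Prop :=
  if p is t :: p' then t.1 = 0 /\ ncoefs_zero p' else True.

Section NormalForm.
Variables (R : zmodType) (mul : R -> R -> R).
Hypothesis HR : assoc_ring_axioms mul.
Variable env : seq R.

Let mulA x y z : mul x (mul y z) = mul (mul x y) z.
Proof. by case: HR. Qed.
Let mulDl x y z : mul (x + y) z = mul x z + mul y z.
Proof. by case: HR. Qed.
Let mulDr x y z : mul x (y + z) = mul x y + mul x z.
Proof. by case: HR. Qed.

Lemma rmul0l x : mul 0 x = 0.
Proof. by apply: (addrI (mul 0 x)); rewrite -mulDl !addr0. Qed.

Lemma rmul0r x : mul x 0 = 0.
Proof. by apply: (addrI (mul x 0)); rewrite -mulDr !addr0. Qed.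

Lemma rmulNl x y : mul (- x) y = - mul x y.
Proof. by apply: (addrI (mul x y)); rewrite -mulDl !subrr rmul0l. Qed.

Lemma rmulNr x y : mul x (- y) = - mul x y.
Proof. by apply: (addrI (mul x y)); rewrite -mulDr !subrr rmul0r. Qed.

Lemma rmulzl x y c : mul (x *~ c) y = mul x y *~ c.
Proof.
have H k : mul (x *+ k) y = mul x y *+ k.
  by elim: k => [|k IH]; rewrite ?mulr0n ?rmul0l // !mulrS mulDl IH.
by case: c => k; rewrite ?NegzE ?mulrNz ?rmulNl /= -!pmulrn H.
Qed.

Lemma rmulzr x y c : mul x (y *~ c) = mul x y *~ c.
Proof.
have H k : mul x (y *+ k) = mul x y *+ k.
  by elim: k => [|k IH]; rewrite ?mulr0n ?rmul0r // !mulrS mulDr IH.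
by case: c => k; rewrite ?NegzE ?mulrNz ?rmulNr /= -!pmulrn H.
Qed.

Fixpoint neval (e : nexp) : R :=
  match e with
  | NZero => 0
  | NVar i => nth 0 env i
  | NAdd a b => neval a + neval b
  | NOpp a => - neval a
  | NMul a b => mul (neval a) (neval b)
  | NScale c a => neval a *~ c
  end.

Fixpoint weval (i : nat) (w : seq nat) : R :=
  if w is j :: w' then mul (nth 0 env i) (weval j w') else nth 0 env i.

Fixpoint npoly_eval (p : seq nmono) : R :=
  if p is t :: p' then weval t.2.1 t.2.2 *~ t.1 + npoly_eval p' else 0.

Lemma nat_cmp_eq i j : nat_cmp i j = Eq -> i = j.
Proof. by elim: i j => [|i IH] [|j] //= /IH ->. Qed.

Lemma word_cmp_eq u v : word_cmp u v = Eq -> u = v.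
Proof.
elim: u v => [|i u IH] [|j v] //=.
by case E: (nat_cmp i j) => // /IH ->; rewrite (nat_cmp_eq E).
Qed.

Arguments word_cmp : simpl never.

Lemma npoly_insert_eval t p :
  npoly_eval (npoly_insert t p) = weval t.2.1 t.2.2 *~ t.1 + npoly_eval p.
Proof.
elim: p => [|t' p IH] //=.
case E: (word_cmp _ _) => //=; last by rewrite IH addrCA.
by case: t t' E {IH} => [c [i u]] [c' [j v]] /= /(@word_cmp_eq (_ :: _) (_ :: _)) [-> ->];
  rewrite mulrzDr addrA.
Qed.

Lemma npoly_add_eval p q :
  npoly_eval (npoly_add p q) = npoly_eval p + npoly_eval q.
Proof.
by elim: p => [|t p IH] /=; rewrite ?add0r // npoly_insert_eval IH addrA.
Qed.

Lemma npoly_scale_eval c p : npoly_eval (npoly_scale c p) = npoly_eval p *~ c.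
Proof.
by elim: p => [|t p IH] /=; rewrite ?mul0rz // IH mulrzDl mulrC mulrzA.
Qed.

Lemma weval_cat i u j v :
  weval i (word_cat u (j :: v)) = mul (weval i u) (weval j v).
Proof. by elim: u i => [|k u IH] i //=; rewrite -mulA IH. Qed.

Lemma npoly_lmul_eval t p :
  npoly_eval (npoly_lmul t p) = mul (weval t.2.1 t.2.2 *~ t.1) (npoly_eval p).
Proof.
elim: p => [|t' p IH] /=; first by rewrite rmul0r.
by rewrite IH mulDr weval_cat !rmulzl rmulzr -mulrzA mulrC.
Qed.

Lemma npoly_mul_eval p q :
  npoly_eval (npoly_mul p q) = mul (npoly_eval p) (npoly_eval q).
Proof.
elim: p => [|t p IH] /=; first by rewrite rmul0l.
by rewrite npoly_add_eval npoly_lmul_eval IH mulDl.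
Qed.

Lemma npoly_of_eval e : npoly_eval (npoly_of e) = neval e.
Proof.
elim: e => [|i|a IHa b IHb|a IHa|a IHa b IHb|c a IHa] //=.
- by rewrite addr0.
- by rewrite npoly_add_eval IHa IHb.
- by rewrite npoly_scale_eval IHa mulrN1z.
- by rewrite npoly_mul_eval IHa IHb.
- by rewrite npoly_scale_eval IHa.
Qed.

Lemma ncoefs_zero_eval p : ncoefs_zero p -> npoly_eval p = 0.
Proof. by elim: p => [|t p IH] //= [-> /IH ->]; rewrite addr0. Qed.

Lemma nring_correct a b :
  ncoefs_zero (npoly_of (NAdd a (NOpp b))) -> neval a = neval b.
Proof.
move=> /ncoefs_zero_eval; rewrite npoly_of_eval /= => /eqP.
by rewrite subr_eq0 => /eqP.
Qed.

End NormalForm.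

(** * Reification of ring expressions *)

Ltac nr_mem x l :=
  lazymatch l with
  | nil => constr:(false)
  | cons x _ => constr:(true)
  | cons _ ?l' => nr_mem x l'
  end.
Ltac nr_atoms mul e l :=
  lazymatch e with
  | GRing.zero => l
  | GRing.add ?a ?b => let l1 := nr_atoms mul a l in nr_atoms mul b l1
  | GRing.opp ?a => nr_atoms mul a l
  | mul ?a ?b => let l1 := nr_atoms mul a l in nr_atoms mul b l1
  | intmul ?a _ => nr_atoms mul a l
  | _ => lazymatch nr_mem e l with true => l | false => constr:(cons e l) end
  end.
Ltac nr_index x l :=
  lazymatch l with
  | cons x _ => constr:(0%N)
  | cons _ ?l' => let i := nr_index x l' in constr:(S i)
  end.
Ltac nr_reify mul e l :=
  lazymatch e with
  | GRing.zero => constr:(NZero)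
  | GRing.add ?a ?b =>
      let a' := nr_reify mul a l in let b' := nr_reify mul b l in constr:(NAdd a' b')
  | GRing.opp ?a => let a' := nr_reify mul a l in constr:(NOpp a')
  | mul ?a ?b =>
      let a' := nr_reify mul a l in let b' := nr_reify mul b l in constr:(NMul a' b')
  | intmul ?a ?c => let a' := nr_reify mul a l in constr:(NScale c a')
  | _ => let i := nr_index e l in constr:(NVar i)
  end.
Ltac nring_pre :=
  match goal with
  | HR : assoc_ring_axioms ?mul |- @eq ?T ?a ?b =>
      let l0 := nr_atoms mul a (@nil T) in
      let l := nr_atoms mul b l0 in
      let a' := nr_reify mul a l in
      let b' := nr_reify mul b l in
      apply: (@nring_correct _ mul HR l a' b');
      cbv beta iota zeta delta [npoly_of npoly_add npoly_mul npoly_lmul npoly_scale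
        npoly_insert ncoefs_zero nat_cmp word_cmp word_cat fst snd]
  end.
Ltac nring := nring_pre; repeat split; ring.

(** * Linear combinations of equations *)

Section EquationAlgebra.
Variables (R : zmodType) (mul : R -> R -> R).

Lemma eqn_add (a b c d : R) : a = b -> c = d -> a + c = b + d.
Proof. by move=> -> ->. Qed.
Lemma eqn_sub (a b c d : R) : a = b -> c = d -> a - c = b - d.
Proof. by move=> -> ->. Qed.
Lemma eqn_scale (a b : R) (c : int) : a = b -> a *~ c = b *~ c.
Proof. by move=> ->. Qed.
Lemma eqn_lmul (x a b : R) : a = b -> mul x a = mul x b.
Proof. by move=> ->. Qed.
Lemma eqn_rmul (x a b : R) : a = b -> mul a x = mul b x.
Proof. by move=> ->. Qed.
Lemma eqn_conclude (a b p q : R) : a = b -> p - q = a - b -> p = q.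
Proof. by move=> -> /eqP; rewrite subrr subr_eq0 => /eqP. Qed.
End EquationAlgebra.

Declare Scope eqn_scope.
Delimit Scope eqn_scope with eqn.
Notation "e + f" := (eqn_add e f) : eqn_scope.
Notation "e - f" := (eqn_sub e f) : eqn_scope.
Notation "e ** c" := (eqn_scale c%R e) (at level 40, left associativity) : eqn_scope.
(* [lincomb e] proves [p = q] from [e : a = b] when [p - q = a - b] holds formally. *)
Tactic Notation "lincomb" uconstr(e) := refine (eqn_conclude e _); nring.

(** * Semiprime rings *)

Section SemiprimeRing.
Variables (R : zmodType) (mul : R -> R -> R).
Hypothesis HR : assoc_ring_axioms mul.
Local Notation "x '⋅' y" := (mul x y) (at level 39, left associativity).
Local Notation "x '*>' e" := (eqn_lmul mul x e)
  (at level 38, right associativity) : eqn_scope.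
Local Notation "e '<*' x" := (eqn_rmul mul x e)
  (at level 39, left associativity) : eqn_scope.

Definition regular (c : int) : Prop := forall x : R, x *~ c = 0 -> x = 0.

Lemma regularM (c d : int) : regular c -> regular d -> regular (c * d).
Proof. by move=> hc hd x; rewrite mulrzA => /hd /hc. Qed.

Lemma regularX (c : int) k : regular c -> regular (c ^+ k).
Proof.
move=> hc; elim: k => [|k IH] x; first by rewrite expr0 mulr1z.
by rewrite exprS; apply: regularM.
Qed.

Ltac regularity :=
  repeat first [assumption | apply: regularM | apply: regularX].

Lemma additive0 (T : R -> R) : additive_map T -> T 0 = 0.
Proof. by move=> hT; apply: (addrI (T 0)); rewrite -hT !addr0. Qed.

Lemma additiveN (T : R -> R) x : additive_map T -> T (- x) = - T x.
Proof.
by move=> hT; apply: (addrI (T x)); rewrite -hT !subrr additive0.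
Qed.

Definition perp (a b : R) : Prop := forall y, a ⋅ y ⋅ b = 0.

Hypothesis sp : semiprime mul.

Lemma perp_sym a b : perp a b -> perp b a.
Proof.
move=> h y; apply: sp => r.
by lincomb (b *> (y *> h r <* y) <* a)%eqn.
Qed.

Lemma triple_zero a : (forall y z, a ⋅ y ⋅ a ⋅ z ⋅ a = 0) -> a = 0.
Proof.
move=> h; apply: sp => y; apply: sp => z.
by lincomb (h y z <* y <* a)%eqn.
Qed.

(** Here [c] need not be regular; this handles factors such as [2 * m + n], for which no regularity
    is assumed. *)
Lemma regular_sq (c : int) (x : R) : x *~ (c * c) = 0 -> x *~ c = 0.
Proof.
move=> h; apply: sp => r.
by lincomb (h <* r <* x)%eqn.
Qed.

(* If p = b y c = - a y q, then p w p ends up containing c w a = 0. *)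
Lemma perp_absorb a b c q :
  perp a c -> (forall y, b ⋅ y ⋅ c + a ⋅ y ⋅ q = 0) -> perp b c.
Proof.
move=> /perp_sym ac h y; apply: sp => w.
by lincomb ((b ⋅ y ⋅ c ⋅ w) *> h y - (b ⋅ y) *> ac w <* (y ⋅ q))%eqn.
Qed.

(** The elements satisfying [N] form a two-sided ideal with zero cubes. Linearizing the cube and
    using semiprimeness twice gives zero squares; linearizing the square then gives [a = 0]. *)
Lemma nil_cube_perp a : regular 2 ->
  (forall x, perp a (x ⋅ x ⋅ x)) -> a = 0.
Proof.
move=> reg2.
pose N b := forall x, perp b (x ⋅ x ⋅ x).
have Nl r b : N b -> N (r ⋅ b).
  by move=> h x y; lincomb (r *> h x y)%eqn.
have Nr r b : N b -> N (b ⋅ r).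
  by move=> h x y; lincomb (h x (r ⋅ y))%eqn.
have ND b c : N b -> N c -> N (b + c).
  by move=> hb hc x y; lincomb (hb x y + hc x y)%eqn.
have NN b : N b -> N (- b).
  by move=> h x y; lincomb (h x y ** (-1))%eqn.
have cube b : N b -> b ⋅ b ⋅ b = 0.
  move=> h; apply: sp => y.
  by lincomb (b *> (b *> h b y))%eqn.
have cube_lin x z : N x -> N z -> x ⋅ x ⋅ z + x ⋅ z ⋅ x + z ⋅ x ⋅ x = 0.
  move=> hx hz; apply: reg2.
  by lincomb (cube (x + z)%R (ND _ _ hx hz) - cube (x - z)%R (ND _ _ hx (NN _ hz))
    - cube z hz ** 2)%eqn.
have square x : N x -> x ⋅ x = 0.
  move=> hx.
  have kill z : N z -> x ⋅ x ⋅ z ⋅ x ⋅ x = 0.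
    move=> hz; by lincomb ((x ⋅ x) *> cube_lin x z hx hz
      - cube x hx <* x <* z - cube x hx <* z <* x)%eqn.
  apply: sp => r; apply: sp => r'.
  have hz : N (r ⋅ x ⋅ x ⋅ r' ⋅ x ⋅ x ⋅ r) by do 5!apply: (Nr); apply: Nl.
  by lincomb (kill _ hz)%eqn.
move=> hx.
apply: sp => r; apply: sp => r'.
have hz : N (r ⋅ a ⋅ r' ⋅ a ⋅ r) by do 3!apply: (Nr); apply: Nl.
by lincomb (a *> (square _ (ND _ _ hx hz) - square _ hz)
  - square _ hx <* (r ⋅ a ⋅ r' ⋅ a ⋅ r) - a *> square _ hx)%eqn.
Qed.

(** * Consequences of a Jordan-type identity *)

Section JordanIdentity.
Variables (T : R -> R) (k a b : int).
Hypothesis TD : additive_map T.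
Hypothesis Tsq :
  forall x, T (x ⋅ x) *~ k = T x ⋅ x *~ a + x ⋅ T x *~ b.

Lemma jordan_lin x y : T (x ⋅ y + y ⋅ x) *~ k =
  (T x ⋅ y + T y ⋅ x) *~ a + (x ⋅ T y + y ⋅ T x) *~ b.
Proof.
have e : T (x ⋅ y + y ⋅ x) = T ((x + y) ⋅ (x + y)) - T (x ⋅ x) - T (y ⋅ y).
  by rewrite -!(additiveN _ TD) -!TD; congr T; nring.
have := Tsq (x + y); rewrite TD => h.
by lincomb (e ** k + h - Tsq x - Tsq y)%eqn.
Qed.

Lemma jordan_cube x : T (x ⋅ x ⋅ x) *~ (2 * k ^+ 2) =
  T x ⋅ x ⋅ x *~ (a * (k + a)) + x ⋅ T x ⋅ x *~ (2 * a * b)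
  + x ⋅ x ⋅ T x *~ (b * (k + b)).
Proof.
have e : T (x ⋅ (x ⋅ x) + (x ⋅ x) ⋅ x) = T (x ⋅ x ⋅ x) + T (x ⋅ x ⋅ x).
  by rewrite -TD; congr T; nring.
by lincomb (jordan_lin x (x ⋅ x) ** k - e ** (k ^+ 2)
  + Tsq x <* x ** a + x *> Tsq x ** b)%eqn.
Qed.

(* T(x^4) from x^2 x^2 and from x x^3 + x^3 x. *)
Lemma jordan_fourth x :
  T x ⋅ x ⋅ x ⋅ x *~ (a * (2 * k - a) * (k - a))
  + x ⋅ T x ⋅ x ⋅ x *~ (3 * a * b * (a - k))
  + x ⋅ x ⋅ T x ⋅ x *~ (3 * a * b * (b - k))
  + x ⋅ x ⋅ x ⋅ T x *~ (b * (2 * k - b) * (k - b)) = 0.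
Proof.
have e : T (x ⋅ (x ⋅ x ⋅ x) + (x ⋅ x ⋅ x) ⋅ x)
    = T ((x ⋅ x) ⋅ (x ⋅ x)) + T ((x ⋅ x) ⋅ (x ⋅ x)).
  by rewrite -TD; congr T; nring.
by lincomb (Tsq (x ⋅ x) ** (4 * k ^+ 2)
  + Tsq x <* (x ⋅ x) ** (4 * k * a) + (x ⋅ x) *> Tsq x ** (4 * k * b)
  + e ** (2 * k ^+ 3) - jordan_lin x (x ⋅ x ⋅ x) ** (2 * k ^+ 2)
  - jordan_cube x <* x ** a - x *> jordan_cube x ** b)%eqn.
Qed.
End JordanIdentity.

(** * Maps with (m + n) D(x^2) = m D(x) x *)

Section RightDefect.
Variables (D : R -> R) (m n : int).
Local Notation s := (m + n).
Local Notation b := (2 * m + n).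
Hypothesis DD : additive_map D.
Hypothesis Dsq : forall x, D (x ⋅ x) *~ s = D x ⋅ x *~ m.
Hypothesis reg2 : regular 2.
Hypothesis reg3 : regular 3.
Hypothesis regm : regular m.
Hypothesis regn : regular n.
Hypothesis regs : regular s.
Hypothesis rega : regular (m + 2 * n).

Let Dsq' x : D (x ⋅ x) *~ s = D x ⋅ x *~ m + x ⋅ D x *~ 0.
Proof. by rewrite mulr0z addr0 Dsq. Qed.

Let Dlin x y : D (x ⋅ y + y ⋅ x) *~ s = (D x ⋅ y + D y ⋅ x) *~ m.
Proof. by rewrite (jordan_lin DD Dsq') mulr0z addr0. Qed.

(** With [b = 0] only the first coefficient of [jordan_fourth] survives, namely [m n (m + 2 n)]. *)
Lemma defect_cube x : D x ⋅ x ⋅ x ⋅ x = 0.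
Proof.
apply: (regularM (regularM regm regn) rega).
by lincomb (jordan_fourth DD Dsq' x)%eqn.
Qed.

(** Anticommuting twice with [x] expresses [2 x y x] through the anticommutator of [x^2] and [y]. *)
Lemma defect_triple x y : D (x ⋅ y ⋅ x) *~ (2 * s ^+ 2) =
  D x ⋅ x ⋅ y *~ (m * n) + D x ⋅ y ⋅ x *~ (m * b) - D y ⋅ x ⋅ x *~ (m * n).
Proof.
have e : D (x ⋅ (x ⋅ y + y ⋅ x) + (x ⋅ y + y ⋅ x) ⋅ x)
    = D ((x ⋅ x) ⋅ y + y ⋅ (x ⋅ x)) + (D (x ⋅ y ⋅ x) + D (x ⋅ y ⋅ x)).
  by rewrite -!DD; congr D; nring.
by lincomb (Dlin x (x ⋅ y + y ⋅ x)%R ** s - e ** (s ^+ 2) + Dlin x y <* x ** m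
  - Dlin (x ⋅ x) y ** s - Dsq x <* y ** m)%eqn.
Qed.

(** The odd differences at [x ± y] and [x ± 2 y], weighted 8 and -1, lose their part of degree 3 in
    [y] and keep 12 times the linear part. *)
Lemma defect_cube_lin x y : D y ⋅ x ⋅ x ⋅ x
  + D x ⋅ (y ⋅ x ⋅ x + x ⋅ y ⋅ x + x ⋅ x ⋅ y) = 0.
Proof.
apply: (regularM (regularM reg2 reg2) reg3).
have h1 := defect_cube (x + y); have h2 := defect_cube (x - y).
have h3 := defect_cube (x + y *~ 2); have h4 := defect_cube (x - y *~ 2).
move: h1 h2 h3 h4; rewrite !mulrz_nat !mulr2n !opprD !DD !(additiveN _ DD) => h1 h2 h3 h4.
by lincomb ((h1 - h2) ** 8 - (h3 - h4))%eqn.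
Qed.

(* Both evaluations of D(x^2 y x^2). *)
Lemma defect_middle x y :
  D x ⋅ x ⋅ x ⋅ y ⋅ x *~ (m * n) - D x ⋅ x ⋅ y ⋅ x ⋅ x *~ (2 * m ^+ 2)
  + D x ⋅ y ⋅ x ⋅ x ⋅ x *~ (2 * b * s) = 0.
Proof.
apply: (regularM regm regn).
have e : x ⋅ x ⋅ y ⋅ (x ⋅ x) = x ⋅ (x ⋅ y ⋅ x) ⋅ x by nring.
have h := defect_triple (x ⋅ x) y; rewrite e in h.
by lincomb ((defect_triple x (x ⋅ y ⋅ x) - h) ** (2 * s ^+ 2)
  - Dsq x <* (x ⋅ x ⋅ y) ** (2 * s * m * n) - Dsq x <* (y ⋅ x ⋅ x) ** (2 * s * m * b)
  - defect_triple x y <* (x ⋅ x) ** (m * n) - defect_cube x <* y ** (2 * s * m ^+ 2 * n)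
  + defect_cube_lin x y <* x ** (m * n * (m * n + 2 * s ^+ 2)))%eqn.
Qed.

(** As [b] may fail to be regular, multiples by [2 b s] are carried along. The power of [x] to the
    right of [y] is lowered until [D x x^2 y x = 0], which kills [D x x^2 y D x x^2]. *)
Lemma defect_square x : D x ⋅ x ⋅ x = 0.
Proof.
have mid := defect_middle x; have cube := defect_cube x.
have k1 y : D x ⋅ x ⋅ x ⋅ y ⋅ x ⋅ x *~ (2 * m ^+ 2)
    = D x ⋅ x ⋅ y ⋅ x ⋅ x ⋅ x *~ (2 * b * s).
  by lincomb (cube <* (y ⋅ x) ** (m * n) - mid (x ⋅ y))%eqn.
have k2 y : D x ⋅ x ⋅ x ⋅ y ⋅ x ⋅ x ⋅ x *~ (2 * b * s) = 0.
  by lincomb (cube <* (y ⋅ x ⋅ x) ** (2 * m ^+ 2) - k1 (x ⋅ y))%eqn.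
have k3 y : D x ⋅ x ⋅ y ⋅ x ⋅ x ⋅ x ⋅ x *~ (2 * b * s) = 0.
  apply: regular_sq.
  by lincomb (k2 y ** (2 * m ^+ 2) - k1 y <* x ** (2 * b * s))%eqn.
have k4 y : D x ⋅ x ⋅ x ⋅ y ⋅ x ⋅ x ⋅ x = 0.
  by apply: (regularM (regularM reg2 regm) regm); lincomb (k3 y + k1 y <* x)%eqn.
have k5 y : D x ⋅ x ⋅ x ⋅ y ⋅ x ⋅ x = 0.
  apply: sp => z; apply: (regularM (regularM reg2 regm) regm).
  by lincomb (k1 (y ⋅ x ⋅ x ⋅ z ⋅ D x ⋅ x ⋅ x ⋅ y)
    + (D x ⋅ x ⋅ y ⋅ x ⋅ x ⋅ z) *> k4 y ** (2 * b * s))%eqn.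
have k6 y : D x ⋅ x ⋅ y ⋅ x ⋅ x ⋅ x *~ (2 * b * s) = 0.
  by lincomb (k5 y ** (2 * m ^+ 2) - k1 y)%eqn.
have k7 y : D x ⋅ y ⋅ x ⋅ x ⋅ x ⋅ x *~ (2 * b * s) = 0.
  apply: regular_sq.
  by lincomb (mid y <* x ** (2 * b * s) - k5 y ** (m * n * (2 * b * s)) + k6 y ** (2 * m ^+ 2))%eqn.
have k8 y : D x ⋅ x ⋅ y ⋅ x ⋅ x ⋅ x = 0.
  apply: (regularM (regularM reg2 regm) regm).
  by lincomb (k7 y + k5 y ** (m * n) - mid y <* x)%eqn.
have k9 y : D x ⋅ x ⋅ x ⋅ y ⋅ x = 0.
  apply: sp => z; apply: (regularM regm regn).
  by lincomb (mid (y ⋅ x ⋅ z ⋅ D x ⋅ x ⋅ x ⋅ y)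
    + (D x ⋅ x ⋅ y ⋅ x ⋅ z) *> k5 y ** (2 * m ^+ 2)
    - (D x ⋅ y ⋅ x ⋅ z) *> k4 y ** (2 * b * s))%eqn.
by apply: sp => y; lincomb (k9 (y ⋅ D x) <* x)%eqn.
Qed.
Lemma defect_square_lin x y : D y ⋅ x ⋅ x + D x ⋅ (y ⋅ x + x ⋅ y) = 0.
Proof.
have h1 := defect_square (x + y); have h2 := defect_square (x - y).
move: h1 h2; rewrite !DD !(additiveN _ DD) => h1 h2.
by apply: reg2; lincomb (h1 - h2 - defect_square y ** 2)%eqn.
Qed.

Lemma defect_triple_square x y :
  D (x ⋅ y ⋅ x) *~ (s ^+ 2) = D x ⋅ x ⋅ y *~ (m * n) + D x ⋅ y ⋅ x *~ (m * s).
Proof.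
apply/eqP; rewrite -subr_eq0; apply/eqP; apply: reg2.
by lincomb (defect_triple x y - defect_square_lin x y ** (m * n))%eqn.
Qed.

(** [D (x z x) x^2] is computed both from the linearized square relation and from the triple
    formula. *)
Lemma defect_perp_cube x : perp (D x) (x ⋅ x ⋅ x).
Proof.
move=> y.
have sq := defect_square x.
have rel z : D x ⋅ x ⋅ z ⋅ x ⋅ x *~ (s ^+ 2 + m * n)
    + D x ⋅ z ⋅ x ⋅ x ⋅ x *~ (m * s) = 0.
  by lincomb (defect_square_lin x (x ⋅ z ⋅ x) ** (s ^+ 2)
    - defect_triple_square x z <* (x ⋅ x) - sq <* (z ⋅ x) ** (s ^+ 2))%eqn.
have k1 z : D x ⋅ x ⋅ z ⋅ x ⋅ x ⋅ x = 0.
  apply: (regularM regm regs).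
  by lincomb (rel (x ⋅ z) - sq <* (z ⋅ x ⋅ x) ** (s ^+ 2 + m * n))%eqn.
have k2 z : D x ⋅ x ⋅ z ⋅ x ⋅ x = 0.
  apply: sp => w; apply: (regularM (regularM reg2 regm) regm).
  by lincomb (sq <* (z ⋅ x ⋅ x ⋅ w ⋅ D x ⋅ x ⋅ z ⋅ x) ** (m * n)
    - defect_middle x (z ⋅ x ⋅ x ⋅ w ⋅ D x ⋅ x ⋅ z)
    + (D x ⋅ z ⋅ x ⋅ x ⋅ w) *> k1 z ** (2 * b * s))%eqn.
apply: (regularM regm regs).
by lincomb (rel y - k2 y ** (s ^+ 2 + m * n))%eqn.
Qed.

Lemma defect_eq0 z : D z = 0.
Proof.
apply: nil_cube_perp => // x y.
apply: (perp_absorb (defect_perp_cube x)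
  (q := z ⋅ x ⋅ x + x ⋅ z ⋅ x + x ⋅ x ⋅ z)) => {}y.
have h1 := defect_perp_cube (x + z) y; have h2 := defect_perp_cube (x - z) y.
have h3 := defect_perp_cube (x + z *~ 2) y.
have h4 := defect_perp_cube (x - z *~ 2) y.
move: h1 h2 h3 h4; rewrite !mulrz_nat !mulr2n !opprD !DD !(additiveN _ DD).
move=> h1 h2 h3 h4; apply: (regularM (regularM reg2 reg2) reg3).
by lincomb ((h1 - h2) ** 8 - (h3 - h4))%eqn.
Qed.
End RightDefect.

(** * Jordan centralizers are centralizers *)

Section LeftJordan.
Variable T : R -> R.
Hypothesis TD : additive_map T.
Hypothesis Tsq : forall x, T (x ⋅ x) = T x ⋅ x.
Hypothesis reg2 : regular 2.

Let Tlin x y : T (x ⋅ y + y ⋅ x) = T x ⋅ y + T y ⋅ x.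
Proof.
have Tsq1 z : T (z ⋅ z) *~ 1 = T z ⋅ z *~ 1 + z ⋅ T z *~ 0.
  by rewrite Tsq mulr0z addr0.
by have := jordan_lin TD Tsq1 x y; rewrite !mulr1z mulr0z addr0.
Qed.

Let Ttriple x y : T (x ⋅ y ⋅ x) = T x ⋅ y ⋅ x.
Proof.
apply/eqP; rewrite -subr_eq0; apply/eqP; apply: reg2.
have e : T (x ⋅ (x ⋅ y + y ⋅ x) + (x ⋅ y + y ⋅ x) ⋅ x)
    = T ((x ⋅ x) ⋅ y + y ⋅ (x ⋅ x)) + (T (x ⋅ y ⋅ x) + T (x ⋅ y ⋅ x)).
  by rewrite -!TD; congr T; nring.
by lincomb (Tlin x (x ⋅ y + y ⋅ x)%R - e + Tlin x y <* x
  - Tlin (x ⋅ x) y - Tsq x <* y)%eqn.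
Qed.

Let Ttriple_lin x y z : T (x ⋅ y ⋅ z + z ⋅ y ⋅ x) = T x ⋅ y ⋅ z + T z ⋅ y ⋅ x.
Proof.
have e : T ((x + z) ⋅ y ⋅ (x + z))
    = T (x ⋅ y ⋅ z + z ⋅ y ⋅ x) + T (x ⋅ y ⋅ x) + T (z ⋅ y ⋅ z).
  by rewrite -!TD; congr T; nring.
have := Ttriple (x + z) y; rewrite TD => h.
by lincomb (h - e - Ttriple x y - Ttriple z y)%eqn.
Qed.

Local Notation B x y := (T (x ⋅ y) - T x ⋅ y).

(** The element [x y z y x + y x z x y], with products [x y] and [y x] as outer factors, also equals
    [x (y z y) x + y (x z x) y]; here only the bracketing differs. The next two lemmas polarize in
    [x] and then in [y]. *)
Let B_comm_same x y : perp (B x y) (x ⋅ y - y ⋅ x).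
Proof.
move=> z.
have e : T ((x ⋅ y) ⋅ z ⋅ (y ⋅ x) + (y ⋅ x) ⋅ z ⋅ (x ⋅ y))
    = T (x ⋅ (y ⋅ z ⋅ y) ⋅ x) + T (y ⋅ (x ⋅ z ⋅ x) ⋅ y).
  by rewrite -TD; congr T; nring.
have h := Tlin x y; rewrite TD in h.
by lincomb (Ttriple_lin (x ⋅ y) z (y ⋅ x) - e - Ttriple x (y ⋅ z ⋅ y)
  - Ttriple y (x ⋅ z ⋅ x) + h <* (z ⋅ x ⋅ y))%eqn.
Qed.

Let B_comm_left x y u : perp (B x y) (u ⋅ y - y ⋅ u).
Proof.
apply: (perp_absorb (B_comm_same u y) (q := x ⋅ y - y ⋅ x)) => z.
have e : T ((x + u) ⋅ y) = T (x ⋅ y) + T (u ⋅ y) by rewrite -TD; congr T; nring.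
have := B_comm_same (x + u) y z; rewrite e TD => h.
by lincomb (h - B_comm_same x y z - B_comm_same u y z)%eqn.
Qed.

Let B_comm x y u v : perp (B x y) (u ⋅ v - v ⋅ u).
Proof.
apply: (perp_absorb (B_comm_left x v u) (q := u ⋅ y - y ⋅ u)) => z.
have e : T (x ⋅ (y + v)) = T (x ⋅ y) + T (x ⋅ v) by rewrite -TD; congr T; nring.
have := B_comm_left x (y + v) u z; rewrite e => h.
by lincomb (h - B_comm_left x y u z - B_comm_left x v u z)%eqn.
Qed.

(** The defect [c] kills all commutators, hence is central. Two values of [T (c c w)] give
    [T w c^2 = T c w c]; taking [w = x y] and [w = x] yields [c^3 = 0], and a central nilpotent
    element is zero. *)
Lemma left_jordan_centralizer x y : T (x ⋅ y) = T x ⋅ y.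
Proof.
suff c0 : B x y = 0 by lincomb c0.
have cperp := B_comm x y.
set c := B x y in cperp *.
have central v : c ⋅ v = v ⋅ c.
  apply/eqP; rewrite -subr_eq0; apply/eqP; apply: sp => z.
  by lincomb (cperp c v (v ⋅ z) - v *> cperp c v z)%eqn.
have Tc w : T (c ⋅ w) *~ 2 = T c ⋅ w + T w ⋅ c.
  by rewrite -Tlin -central mulrz_nat mulr2n TD.
have Tcc w : T w ⋅ c ⋅ c = T c ⋅ w ⋅ c.
  have e : T (c ⋅ (c ⋅ w)) = T (c ⋅ c ⋅ w) by congr T; nring.
  have Tc2 : T (c ⋅ c ⋅ w) *~ 2 = T (c ⋅ c) ⋅ w + T w ⋅ (c ⋅ c).
    rewrite -Tlin mulrz_nat mulr2n -TD; congr T.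
    by lincomb (c *> central w + central w <* c)%eqn.
  by lincomb (Tc (c ⋅ w) ** 2 + Tc w <* c - Tc2 ** 2 - e ** 4 - Tsq c <* w ** 2)%eqn.
have c3 : c ⋅ c ⋅ c = 0.
  have cE : c = T (x ⋅ y) - T x ⋅ y by [].
  (* Only the leftmost factor is expanded; the other two remain atoms for [nring]. *)
  rewrite [X in X ⋅ c ⋅ c]cE; clearbody c.
  by lincomb (Tcc (x ⋅ y) - Tcc x <* y + T x *> (c *> central y + central y <* c)
    - (T c ⋅ x) *> central y)%eqn.
have c2 : c ⋅ c = 0.
  clearbody c; apply: sp => r.
  by lincomb (c3 <* (r ⋅ c) - (c ⋅ c) *> central r <* c)%eqn.
clearbody c; apply: sp => r.
by lincomb (c2 <* r - c *> central r)%eqn.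
Qed.
End LeftJordan.

(** * (m, n)-Jordan centralizers *)

(* In the comments, L and L' are left multiplication by x of the first and of
   the second factor u in u y u. *)
Section BilinearElimination.
Variables (x : R) (a n : int).
(** In the application [a] is [m + 2 n], so [b = 2 m + n], [s = m + n] and [delta = m - n]. *)
Local Notation b := (2 * a - 3 * n).
Local Notation s := (a - n).
Local Notation delta := (a - 3 * n).
Local Notation omega := (a ^+ 2 + 3 * n * b).
Hypothesis reg2 : regular 2.
Hypothesis reg3 : regular 3.
Hypothesis rega : regular a.
Hypothesis regn : regular n.
Hypothesis regs : regular s.

Local Notation cubic u y c0 c1 c2 c3 :=
  (x ⋅ x ⋅ x ⋅ u ⋅ y ⋅ u *~ c0 + x ⋅ x ⋅ u ⋅ y ⋅ x ⋅ u *~ c1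
   + x ⋅ u ⋅ y ⋅ x ⋅ x ⋅ u *~ c2 + u ⋅ y ⋅ x ⋅ x ⋅ x ⋅ u *~ c3).

(* (L' - L)^2 (a L' - 3 n L) = 0 and (b L' + a L)^2 (b L' + 3 n L) = 0. *)
Definition cubic1 u := forall y,
  cubic u y (- (3 * n)) (a + 6 * n) (- (2 * a + 3 * n)) a = 0.
Definition cubic2 u := forall y,
  cubic u y (3 * n * a ^+ 2) (a * b * (a + 6 * n)) (b ^+ 2 * (2 * a + 3 * n))
    (b ^+ 3) = 0.

Lemma cubic1_lmul u : cubic1 u -> cubic1 (x ⋅ u).
Proof. by move=> h y; lincomb (x *> h (y ⋅ x))%eqn. Qed.

(* A Bezout identity for the two cubics, with value 108 a^2 s^3 omega^2 L'^5; its
   coefficients solve the Sylvester system. *)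
Lemma cubic_omega u : cubic1 u -> cubic2 u ->
  (x ⋅ x ⋅ x ⋅ x ⋅ x ⋅ u) *~ omega = 0.
Proof.
move=> h1 h2; apply: sp => y.
have reg : regular (2 ^+ 2 * 3 ^+ 3 * a ^+ 2 * s ^+ 3) by regularity.
suff h : u ⋅ y ⋅ x ⋅ x ⋅ x ⋅ x ⋅ x ⋅ u *~ (omega ^+ 2) = 0.
  by lincomb ((x ⋅ x ⋅ x ⋅ x ⋅ x) *> h)%eqn.
apply: reg.
by lincomb (
  (x ⋅ x) *> h1 y ** (3 * a ^+ 2 * n * (4 * a ^+ 5 + 51 * a ^+ 4 * n
    + 72 * a ^+ 3 * n ^+ 2 - 54 * a ^+ 2 * n ^+ 3 - 324 * a * n ^+ 4
    + 243 * n ^+ 5))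
  + x *> h1 (y ⋅ x) ** (2 * a * (4 * a ^+ 7 + 66 * a ^+ 6 * n
    + 216 * a ^+ 5 * n ^+ 2 - 27 * a ^+ 4 * n ^+ 3 - 972 * a ^+ 3 * n ^+ 4
    - 1458 * a ^+ 2 * n ^+ 5 + 4374 * a * n ^+ 6 - 2187 * n ^+ 7))
  + h1 (y ⋅ x ⋅ x) ** (28 * a ^+ 8 + 252 * a ^+ 7 * n - 180 * a ^+ 6 * n ^+ 2
    - 432 * a ^+ 5 * n ^+ 3 - 1863 * a ^+ 4 * n ^+ 4 + 13122 * a ^+ 2 * n ^+ 6
    - 17496 * a * n ^+ 7 + 6561 * n ^+ 8)
  + (x ⋅ x) *> h2 y ** (3 * n * (4 * a ^+ 5 + 51 * a ^+ 4 * n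
    + 72 * a ^+ 3 * n ^+ 2 - 54 * a ^+ 2 * n ^+ 3 - 324 * a * n ^+ 4
    + 243 * n ^+ 5))
  - x *> h2 (y ⋅ x) ** (4 * a ^+ 6 + 81 * a ^+ 5 * n + 477 * a ^+ 4 * n ^+ 2
    + 54 * a ^+ 3 * n ^+ 3 - 1134 * a ^+ 2 * n ^+ 4 - 243 * a * n ^+ 5
    + 729 * n ^+ 6)
  + h2 (y ⋅ x ⋅ x) ** (a * (10 * a ^+ 5 + 135 * a ^+ 4 * n
    + 360 * a ^+ 3 * n ^+ 2 - 918 * a ^+ 2 * n ^+ 3 + 162 * a * n ^+ 4
    + 243 * n ^+ 5)))%eqn.
Qed.

(** * The case [omega = 0] on [u]: [3 n (b L' + a L) = - a (a L' - 3 n L)], so the cubics share a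
    factor *)

Section OmegaTorsion.
Variable u : R.
Hypothesis h1 : cubic1 u.
Hypothesis h2 : cubic2 u.
Hypothesis hw : u *~ omega = 0.

(** Modulo [delta], [omega] is [18 n^2], which is regular. *)
Let cancel_delta (v : R) : v *~ omega = 0 -> v *~ delta = 0 -> v = 0.
Proof.
move=> vw vd; have reg : regular (2 * 3 ^+ 2 * n ^+ 2) by regularity.
apply: reg; rewrite (_ : 2 * 3 ^+ 2 * n ^+ 2 = omega - (delta + 12 * n) * delta); last by ring.
by lincomb (vw - vd ** (delta + 12 * n))%eqn.
Qed.

(* With D = a L' - 3 n L, the relations become D (D - delta L)^2 = 0 and
   D^2 (a D + 3 n delta L) = 0. *)
Let step1 y : cubic u y (27 * n ^+ 3 * (delta - a))
  (9 * a * n ^+ 2 * (3 * a - 2 * delta)) (3 * a ^+ 2 * n * (delta - 3 * a))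
  (a ^+ 4) = 0.
Proof.
have reg : regular (a ^+ 4) by regularity.
apply: reg.
by lincomb ((x ⋅ x ⋅ u ⋅ y ⋅ x) *> hw ** (9 * a ^+ 4 * n ^+ 2 + 54 * a ^+ 3 * n ^+ 3)
  + (x ⋅ u ⋅ y ⋅ x ⋅ x) *> hw **
      (- 6 * a ^+ 5 * n + 27 * a ^+ 4 * n ^+ 2 - 81 * a ^+ 2 * n ^+ 4)
  + (u ⋅ y ⋅ x ⋅ x ⋅ x) *> hw **
      (a ^+ 6 - 6 * a ^+ 5 * n + 45 * a ^+ 4 * n ^+ 2
       - 108 * a ^+ 3 * n ^+ 3 + 81 * a ^+ 2 * n ^+ 4)
  - h2 y ** (27 * n ^+ 3 * a ^+ 2))%eqn.
Qed.

(* D L (a delta L - (2 a + 3 n) D) = 0 *)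
Let step2 y : cubic u y (- (9 * n ^+ 2 * (2 * a + 3 * n)) - 3 * n * a * delta)
  (6 * n * a * (2 * a + 3 * n) + a ^+ 2 * delta)
  (- ((2 * a + 3 * n) * a ^+ 2)) 0 = 0.
Proof.
apply: cancel_delta; last by lincomb (h1 y ** (a ^+ 3) - step1 y)%eqn.
by lincomb ((x ⋅ x ⋅ x ⋅ u ⋅ y) *> hw **
    (- (9 * n ^+ 2 * (2 * a + 3 * n)) - 3 * n * a * delta)
  + (x ⋅ x ⋅ u ⋅ y ⋅ x) *> hw ** (6 * n * a * (2 * a + 3 * n) + a ^+ 2 * delta)
  + (x ⋅ u ⋅ y ⋅ x ⋅ x) *> hw ** (- ((2 * a + 3 * n) * a ^+ 2)))%eqn.
Qed.

(* D^3 L = 0 *)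
Let step3 y : x ⋅ (cubic u y (- (27 * n ^+ 3)) (27 * a * n ^+ 2)
  (- (9 * a ^+ 2 * n)) (a ^+ 3)) = 0.
Proof.
have reg : regular (2 * 3 ^+ 2 * n ^+ 2) by regularity.
apply: reg.
by lincomb (x *> step1 y ** a
  - (step2 (y ⋅ x) ** a - x *> step2 y ** (3 * n)) ** (3 * n)
  - (x ⋅ x ⋅ x ⋅ x ⋅ u ⋅ y) *> hw ** (- (27 * n ^+ 3))
  - (x ⋅ x ⋅ x ⋅ u ⋅ y ⋅ x) *> hw ** (27 * a * n ^+ 2)
  - (x ⋅ x ⋅ u ⋅ y ⋅ x ⋅ x) *> hw ** (- (9 * a ^+ 2 * n))
  - (x ⋅ u ⋅ y ⋅ x ⋅ x ⋅ x) *> hw ** (a ^+ 3))%eqn.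
Qed.

(* D^2 L^2 = 0 *)
Let step4 y : x ⋅ (x ⋅ x ⋅ x ⋅ u ⋅ y ⋅ u *~ (9 * n ^+ 2)
  - x ⋅ x ⋅ u ⋅ y ⋅ x ⋅ u *~ (6 * a * n)
  + x ⋅ u ⋅ y ⋅ x ⋅ x ⋅ u *~ (a ^+ 2)) = 0.
Proof.
apply: cancel_delta.
  by lincomb ((x ⋅ x ⋅ x ⋅ x ⋅ u ⋅ y) *> hw ** (9 * n ^+ 2)
    - (x ⋅ x ⋅ x ⋅ u ⋅ y ⋅ x) *> hw ** (6 * a * n)
    + (x ⋅ x ⋅ u ⋅ y ⋅ x ⋅ x) *> hw ** (a ^+ 2))%eqn.
apply: rega.
by lincomb (step2 (y ⋅ x) ** a - x *> step2 y ** (3 * n)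
  + step3 y ** (2 * a + 3 * n))%eqn.
Qed.

(* D L^3 = 0 *)
Let step5 y : x ⋅ x ⋅ x ⋅ u ⋅ y ⋅ x ⋅ u *~ a
  - x ⋅ x ⋅ x ⋅ x ⋅ u ⋅ y ⋅ u *~ (3 * n) = 0.
Proof.
apply: cancel_delta.
  by lincomb ((x ⋅ x ⋅ x ⋅ u ⋅ y ⋅ x) *> hw ** a
    - (x ⋅ x ⋅ x ⋅ x ⋅ u ⋅ y) *> hw ** (3 * n))%eqn.
apply: rega.
by lincomb (x *> step2 y + step4 y ** (2 * a + 3 * n))%eqn.
Qed.

(* On u y u z u the relation D L^3 = 0 holds for each pair of factors, so
   L2 = L3 = (3 n / a) L1 and L3 = (3 n / a) L2 up to powers of L1. *)
Lemma omega_torsion_nilpotent : x ⋅ x ⋅ x ⋅ x ⋅ x ⋅ x ⋅ x ⋅ u = 0.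
Proof.
have reg : regular (3 ^+ 4 * n ^+ 4) by regularity.
have e y z : x ⋅ x ⋅ x ⋅ x ⋅ x ⋅ x ⋅ x ⋅ u ⋅ y ⋅ u ⋅ z ⋅ u = 0.
  apply: cancel_delta; first by
    lincomb ((x ⋅ x ⋅ x ⋅ x ⋅ x ⋅ x ⋅ x ⋅ u ⋅ y ⋅ u ⋅ z) *> hw)%eqn.
  apply: reg.
  by lincomb ((x ⋅ x ⋅ x ⋅ u ⋅ y) *> step5 z ** (a ^+ 4)
    - (step5 (y ⋅ x ⋅ x) ** (a ^+ 2) + x *> step5 (y ⋅ x) ** (3 * n * a)
       + (x ⋅ x) *> step5 y ** (9 * n ^+ 2)) <* (z ⋅ x ⋅ u) ** (a ^+ 2)
    + (step5 (y ⋅ x ⋅ x ⋅ x) ** (a ^+ 3)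
       + x *> step5 (y ⋅ x ⋅ x) ** (3 * n * a ^+ 2)
       + (x ⋅ x) *> step5 (y ⋅ x) ** (9 * n ^+ 2 * a)
       + (x ⋅ x ⋅ x) *> step5 y ** (27 * n ^+ 3)) <* (z ⋅ u) ** (3 * n)
    - (x ⋅ x ⋅ x) *> step5 (y ⋅ u ⋅ z) ** (27 * n ^+ 3 * a))%eqn.
apply: triple_zero => y z.
by lincomb (e (y ⋅ x ⋅ x ⋅ x ⋅ x ⋅ x ⋅ x ⋅ x) (z ⋅ x ⋅ x ⋅ x ⋅ x ⋅ x ⋅ x ⋅ x))%eqn.
Qed.
End OmegaTorsion.
(** Modulo [L^3] and [L'^3], the first cubic times [2 L' + L] is [9 n L^2 L'^2]. *)
Lemma cubic1_descent u : cubic1 u -> x ⋅ x ⋅ x ⋅ u = 0 -> x ⋅ x ⋅ u = 0.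
Proof.
move=> h1 h0; apply: sp => y.
have reg : regular (3 ^+ 2 * n) by regularity.
apply: reg.
by lincomb (h1 (y ⋅ x) ** 2 + x *> h1 y - h0 <* (y ⋅ x ⋅ u) ** a
  + x *> h0 <* (y ⋅ u) ** (3 * n) + (x ⋅ u ⋅ y) *> h0 ** (3 * a + 6 * n)
  - (u ⋅ y ⋅ x) *> h0 ** (2 * a))%eqn.
Qed.

Lemma cubic1_nilpotent k u :
  cubic1 u -> iter k (mul x) (x ⋅ x ⋅ u) = 0 -> x ⋅ x ⋅ u = 0.
Proof.
elim: k u => [|k IH] u h1 //.
rewrite iterSr (_ : x ⋅ (x ⋅ x ⋅ u) = x ⋅ x ⋅ (x ⋅ u)); last by nring.
move=> /(IH _ (cubic1_lmul h1)) h0; apply: cubic1_descent => //.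
by lincomb h0.
Qed.

Lemma cubic12_square u : cubic1 u -> cubic2 u -> x ⋅ x ⋅ u = 0.
Proof.
(* The claim becomes [x^12 u = 0]: five factors come from [cubic_omega] and seven from
   [omega_torsion_nilpotent]. *)
move=> h1 h2; apply: (@cubic1_nilpotent 10) => //.
have h1' : cubic1 (x ⋅ x ⋅ x ⋅ x ⋅ x ⋅ u).
  by move=> y; lincomb ((x ⋅ x ⋅ x ⋅ x ⋅ x) *> h1 (y ⋅ x ⋅ x ⋅ x ⋅ x ⋅ x))%eqn.
have h2' : cubic2 (x ⋅ x ⋅ x ⋅ x ⋅ x ⋅ u).
  by move=> y; lincomb ((x ⋅ x ⋅ x ⋅ x ⋅ x) *> h2 (y ⋅ x ⋅ x ⋅ x ⋅ x ⋅ x))%eqn.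
have h0 := omega_torsion_nilpotent h1' h2' (cubic_omega h1 h2).
by rewrite [iter _ _ _]/=; lincomb h0.
Qed.
End BilinearElimination.

(* L and R are left and right multiplication of F by x, and z is right
   multiplication by x of the factor y in F y. *)
Section Pointwise.
Variables (x t F G : R) (a n : int).
Local Notation b := (2 * a - 3 * n).
Local Notation s := (a - n).
Hypothesis reg2 : regular 2.
Hypothesis reg3 : regular 3.
Hypothesis rega : regular a.
Hypothesis regn : regular n.
Hypothesis regs : regular s.

Hypothesis F_def : F = t ⋅ x - x ⋅ t.
Hypothesis G_def : G = F ⋅ x - x ⋅ F.
Hypothesis GE : G ⋅ x *~ a + x ⋅ G *~ b = 0.
(* (z - L) (s z (a z + b L) F + a (a z - n L) G) = 0 *)
Hypothesis FG : forall y,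
  (F ⋅ y ⋅ x ⋅ x ⋅ x *~ a + x ⋅ F ⋅ y ⋅ x ⋅ x *~ (b - a)
     - x ⋅ x ⋅ F ⋅ y ⋅ x *~ b) *~ s
  + (G ⋅ y ⋅ x ⋅ x *~ a - x ⋅ G ⋅ y ⋅ x *~ (a + n)
     + x ⋅ x ⋅ G ⋅ y *~ n) *~ a = 0.

(* (z - L)^2 (a z - 3 n L) G = 0 *)
Let Grel y : G ⋅ y ⋅ x ⋅ x ⋅ x *~ a - x ⋅ G ⋅ y ⋅ x ⋅ x *~ (2 * a + 3 * n)
  + x ⋅ x ⋅ G ⋅ y ⋅ x *~ (a + 6 * n) - x ⋅ x ⋅ x ⋅ G ⋅ y *~ (3 * n) = 0.
Proof.
apply: regs.
by lincomb (FG (x ⋅ y) - x *> FG y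
  + (G_def <* (y ⋅ x ⋅ x ⋅ x) ** a + x *> G_def <* (y ⋅ x ⋅ x) ** (b - a)
    - (x ⋅ x) *> G_def <* (y ⋅ x) ** b) ** s
  - (GE <* (y ⋅ x ⋅ x) ** a - x *> GE <* (y ⋅ x) ** (a + n)
    + (x ⋅ x) *> GE <* y ** n))%eqn.
Qed.

(** Multiplying [Grel] by [G] on the right gives the first cubic. Putting [y G] for [y] and using
    [GE] amounts to replacing [z] by [- (b / a) L'], which gives the second. *)
Let G_square : x ⋅ x ⋅ G = 0.
Proof.
apply: (@cubic12_square x a n) => // y; first by lincomb (Grel y <* G)%eqn.
by lincomb ((G ⋅ y) *> (GE <* x <* x ** (a ^+ 2) - x *> GE <* x ** (a * b)
    + (x ⋅ x) *> GE ** (b ^+ 2))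
  - (x ⋅ G ⋅ y) *> (GE <* x ** a - x *> GE ** b) ** (2 * a + 3 * n)
  + (x ⋅ x ⋅ G ⋅ y) *> GE ** (a * (a + 6 * n))
  - Grel (y ⋅ G) ** (a ^+ 2))%eqn.
Qed.

(** As [x^2 G = 0], multiplying [Grel] by [x] on the left leaves [x G y x^3 = 0]. Then [Grel] times
    [w x^3] leaves [G y x^3 w x^3 = 0]. *)
Lemma iterated_commutator_perp : perp G (x ⋅ x ⋅ x).
Proof.
have xG y : x ⋅ G ⋅ y ⋅ (x ⋅ x ⋅ x) = 0.
  apply: rega.
  by lincomb (x *> Grel y + G_square <* (y ⋅ x ⋅ x) ** (2 * a + 3 * n)
    - x *> G_square <* (y ⋅ x) ** (a + 6 * n)
    + (x ⋅ x) *> G_square <* y ** (3 * n))%eqn.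
have G2 y w : G ⋅ y ⋅ (x ⋅ x ⋅ x) ⋅ w ⋅ (x ⋅ x ⋅ x) = 0.
  apply: rega.
  by lincomb (Grel y <* (w ⋅ x ⋅ x ⋅ x) + xG (y ⋅ x ⋅ x ⋅ w) ** (2 * a + 3 * n)
    - G_square <* (y ⋅ x ⋅ w ⋅ x ⋅ x ⋅ x) ** (a + 6 * n)
    + x *> G_square <* (y ⋅ w ⋅ x ⋅ x ⋅ x) ** (3 * n))%eqn.
by move=> y; apply: sp => w; lincomb (G2 y (w ⋅ G ⋅ y))%eqn.
Qed.

(** The polynomial is [z (z - L) (a z + b L)]: for [u = F] this is [FG] after the factor [w x^3] has
    removed the terms in [G]. *)
Let Frel u := forall y w, (u ⋅ y ⋅ x ⋅ x ⋅ x *~ a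
  + x ⋅ u ⋅ y ⋅ x ⋅ x *~ (b - a) - x ⋅ x ⋅ u ⋅ y ⋅ x *~ b) ⋅ w ⋅ (x ⋅ x ⋅ x) = 0.

Let Frel_F : Frel F.
Proof.
move=> y w; apply: regs.
by lincomb (FG y <* (w ⋅ x ⋅ x ⋅ x)
  - (iterated_commutator_perp (y ⋅ x ⋅ x ⋅ w) ** a
    - x *> iterated_commutator_perp (y ⋅ x ⋅ w) ** (a + n)
    + (x ⋅ x) *> iterated_commutator_perp (y ⋅ w) ** n) ** a)%eqn.
Qed.

Let Frel_lmul u : Frel u -> Frel (x ⋅ u).
Proof. by move=> h y w; lincomb (x *> h y w)%eqn. Qed.

Let Frel_descent u : Frel u -> perp (x ⋅ u) (x ⋅ x ⋅ x) -> perp u (x ⋅ x ⋅ x).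
Proof.
move=> h xu.
have h2 y w : u ⋅ y ⋅ (x ⋅ x ⋅ x) ⋅ w ⋅ (x ⋅ x ⋅ x) = 0.
  apply: rega.
  by lincomb (h y w - xu (y ⋅ x ⋅ x ⋅ w) ** (b - a) + x *> xu (y ⋅ x ⋅ w) ** b)%eqn.
by move=> y; apply: sp => w; lincomb (h2 y (w ⋅ u ⋅ y))%eqn.
Qed.

(* Comparing y t with y shows that the derivative in z of Frel vanishes at
   z = L' on F y F; its resultant with Frel itself is a s^2 L'^4. *)
Let Frel_derivative y w : (F ⋅ y ⋅ x ⋅ x ⋅ F *~ (3 * a)
  + x ⋅ F ⋅ y ⋅ x ⋅ F *~ (2 * (b - a)) - x ⋅ x ⋅ F ⋅ y ⋅ F *~ b)
  ⋅ w ⋅ (x ⋅ x ⋅ x) = 0.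
Proof.
have Gp := iterated_commutator_perp.
by lincomb (Frel_F (y ⋅ t) w - Frel_F y (t ⋅ w)
  + ((F ⋅ y) *> (F_def <* x <* x + x *> F_def <* x + (x ⋅ x) *> F_def) ** a
     + (x ⋅ F ⋅ y) *> (F_def <* x + x *> F_def) ** (b - a)
     - (x ⋅ x ⋅ F ⋅ y) *> F_def ** b) <* (w ⋅ x ⋅ x ⋅ x)
  + ((F ⋅ y) *> (G_def <* x + x *> G_def ** 2) ** a
     + (x ⋅ F ⋅ y) *> G_def ** (b - a)) <* (w ⋅ x ⋅ x ⋅ x)
  - (F ⋅ y) *> (Gp (x ⋅ w) + x *> Gp w ** 2) ** a
  - (x ⋅ F ⋅ y) *> Gp w ** (b - a))%eqn.
Qed.

(** Elimination yields [F y x^4 F w x^3 = 0], hence [perp (x^4 F) (x^3)]; each use of [Frel_descent]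
    then strips one [x]. *)
Lemma commutator_perp : perp F (x ⋅ x ⋅ x).
Proof.
have reg : regular (3 ^+ 2 * a * s ^+ 2) by regularity.
have h y w : F ⋅ y ⋅ x ⋅ x ⋅ x ⋅ x ⋅ F ⋅ w ⋅ (x ⋅ x ⋅ x) = 0.
  apply: reg.
  (* The terms in [L^2] cancel, leaving [L'^2 (2 a L' + (b - a) L)]. The factor [9 s^2] used next is
     [(a + b)^2]. *)
  have k y' := (Frel_derivative (y' ⋅ x) w - Frel_F y' (F ⋅ w))%eqn.
  by lincomb (k (y ⋅ x) ** (9 * s ^+ 2)
    - (x *> k y ** (b - a) + k (y ⋅ x) ** (2 * a)) ** b
    - Frel_F (y ⋅ x) (F ⋅ w) ** ((b - a) ^+ 2))%eqn.
have h4 : perp (x ⋅ (x ⋅ (x ⋅ (x ⋅ F)))) (x ⋅ x ⋅ x).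
  move=> y; apply: sp => w.
  by lincomb ((x ⋅ x ⋅ x ⋅ x) *> h (y ⋅ x ⋅ x ⋅ x ⋅ w) y)%eqn.
apply: (Frel_descent Frel_F).
apply: (Frel_descent (Frel_lmul Frel_F)).
apply: (Frel_descent (Frel_lmul (Frel_lmul Frel_F))).
exact: (Frel_descent (Frel_lmul (Frel_lmul (Frel_lmul Frel_F)))).
Qed.
End Pointwise.

(** * Commutation of [T x] with [x] *)

Section MNJordan.
Variables (T : R -> R) (m n : int).
Local Notation s := (m + n).
Local Notation a := (m + 2 * n).
Local Notation b := (2 * m + n).
Hypothesis TD : additive_map T.
Hypothesis Tsq :
  forall x, T (x ⋅ x) *~ s = T x ⋅ x *~ m + x ⋅ T x *~ n.
Hypothesis reg2 : regular 2.
Hypothesis reg3 : regular 3.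
Hypothesis regm : regular m.
Hypothesis regn : regular n.
Hypothesis regs : regular s.
Hypothesis rega : regular a.

Let cubic x : T x ⋅ x ⋅ x ⋅ x *~ a - x ⋅ T x ⋅ x ⋅ x *~ (3 * n)
  - x ⋅ x ⋅ T x ⋅ x *~ (3 * m) + x ⋅ x ⋅ x ⋅ T x *~ b = 0.
Proof.
apply: (regularM regm regn).
by lincomb (jordan_fourth TD Tsq x)%eqn.
Qed.

Let cubic_lin x y :
  T y ⋅ x ⋅ x ⋅ x *~ a - x ⋅ T y ⋅ x ⋅ x *~ (3 * n)
  - x ⋅ x ⋅ T y ⋅ x *~ (3 * m) + x ⋅ x ⋅ x ⋅ T y *~ b
  + (T x ⋅ (y ⋅ x ⋅ x + x ⋅ y ⋅ x + x ⋅ x ⋅ y) *~ a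
     - (y ⋅ T x ⋅ x ⋅ x + x ⋅ T x ⋅ (y ⋅ x + x ⋅ y)) *~ (3 * n)
     - ((x ⋅ y + y ⋅ x) ⋅ T x ⋅ x + x ⋅ x ⋅ T x ⋅ y) *~ (3 * m)
     + (y ⋅ x ⋅ x + x ⋅ y ⋅ x + x ⋅ x ⋅ y) ⋅ T x *~ b) = 0.
Proof.
have h1 := cubic (x + y); have h2 := cubic (x - y).
have h3 := cubic (x + y *~ 2); have h4 := cubic (x - y *~ 2).
move: h1 h2 h3 h4; rewrite !mulrz_nat !mulr2n !opprD !TD !(additiveN _ TD).
move=> h1 h2 h3 h4; apply: (regularM (regularM reg2 reg2) reg3).
by lincomb ((h1 - h2) ** 8 - (h3 - h4))%eqn.
Qed.

(* Substituting x y + y x for y eliminates T y. *)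
Let eliminated x y :
  T x ⋅ y ⋅ x ⋅ x ⋅ x *~ (s * a)
  + (T x ⋅ x *~ (a ^+ 2) - x ⋅ T x *~ (n * (4 * m + 5 * n))) ⋅ y ⋅ x ⋅ x
  + (T x ⋅ x ⋅ x *~ (a ^+ 2) - x ⋅ T x ⋅ x *~ (4 * n * a)
     - x ⋅ x ⋅ T x *~ (3 * (m ^+ 2 + m * n - n ^+ 2))) ⋅ y ⋅ x
  + (T x ⋅ x ⋅ x ⋅ x *~ (s * a) - x ⋅ T x ⋅ x ⋅ x *~ (n * (4 * m + 5 * n))
     - x ⋅ x ⋅ T x ⋅ x *~ (3 * (m ^+ 2 + m * n - n ^+ 2))
     + x ⋅ x ⋅ x ⋅ T x *~ (2 * m * a)) ⋅ y
  + x ⋅ x ⋅ x ⋅ y ⋅ T x *~ (s * b)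
  + x ⋅ x ⋅ y ⋅ (x ⋅ T x *~ (b ^+ 2) - T x ⋅ x *~ (m * (5 * m + 4 * n)))
  + x ⋅ y ⋅ (x ⋅ x ⋅ T x *~ (b ^+ 2) - x ⋅ T x ⋅ x *~ (4 * m * b)
     - T x ⋅ x ⋅ x *~ (3 * (n ^+ 2 + m * n - m ^+ 2)))
  + y ⋅ (x ⋅ x ⋅ x ⋅ T x *~ (s * b) - x ⋅ x ⋅ T x ⋅ x *~ (m * (5 * m + 4 * n))
     - x ⋅ T x ⋅ x ⋅ x *~ (3 * (n ^+ 2 + m * n - m ^+ 2))
     + T x ⋅ x ⋅ x ⋅ x *~ (2 * n * b)) = 0.
Proof.
have h := jordan_lin TD Tsq x y.
by lincomb (cubic_lin x (x ⋅ y + y ⋅ x)%R ** s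
  - (h <* (x ⋅ x ⋅ x) ** a - x *> h <* (x ⋅ x) ** (3 * n)
     - (x ⋅ x) *> h <* x ** (3 * m) + (x ⋅ x ⋅ x) *> h ** b)
  - cubic_lin x y <* x ** m - x *> cubic_lin x y ** n)%eqn.
Qed.

Lemma mn_jordan_commutator_perp x : perp (T x ⋅ x - x ⋅ T x) (x ⋅ x ⋅ x).
Proof.
have regs' : regular (a - n) by rewrite (_ : a - n = s); last by ring.
apply: (commutator_perp reg2 reg3 rega regn regs' (erefl _) (erefl _)) => [|y].
  (* Expanded in [T x], the relation [a G x + b x G = 0] is [cubic x]. *)
  by lincomb (cubic x)%eqn.
(* Passing from [y] to [x y] and subtracting [x] times the identity cancels every term with [T x] to
   the right of [y]. *)
by lincomb (eliminated x (x ⋅ y) - x *> eliminated x y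
  - cubic x <* (y ⋅ x) ** a
  - cubic x <* x <* y ** s + x *> cubic x <* y ** a)%eqn.
Qed.

(** [q1], [q2] and [F1] are the mixed components of the cube and of the commutator at [x + z]. The
    parts of degree 1 and 2 in [z] are isolated; absorbing the lower commutators leaves
    [perp (T z z - z T z) (x^3)]. *)
Lemma mn_jordan_commuting z : T z ⋅ z = z ⋅ T z.
Proof.
apply/eqP; rewrite -subr_eq0; apply/eqP; apply: nil_cube_perp => // x.
pose q1 := z ⋅ x ⋅ x + x ⋅ z ⋅ x + x ⋅ x ⋅ z.
pose q2 := z ⋅ z ⋅ x + z ⋅ x ⋅ z + x ⋅ z ⋅ z.
pose F1 := T x ⋅ z + T z ⋅ x - (x ⋅ T z + z ⋅ T x).
have lin y : F1 ⋅ y ⋅ (x ⋅ x ⋅ x) + (T x ⋅ x - x ⋅ T x) ⋅ y ⋅ q1 = 0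
  /\ (T z ⋅ z - z ⋅ T z) ⋅ y ⋅ (x ⋅ x ⋅ x) + F1 ⋅ y ⋅ q1
     + (T x ⋅ x - x ⋅ T x) ⋅ y ⋅ q2 = 0.
  have h0 := mn_jordan_commutator_perp x y.
  have h0' := mn_jordan_commutator_perp z y.
  have h1 := mn_jordan_commutator_perp (x + z) y.
  have h2 := mn_jordan_commutator_perp (x - z) y.
  have h3 := mn_jordan_commutator_perp (x + z *~ 2) y.
  have h4 := mn_jordan_commutator_perp (x - z *~ 2) y.
  move: h1 h2 h3 h4; rewrite !mulrz_nat !mulr2n !opprD !TD !(additiveN _ TD).
  move=> h1 h2 h3 h4; split.
    have reg : regular (2 ^+ 2 * 3) by regularity.
    by apply: reg; rewrite /F1 /q1;
      lincomb ((h1 - h2) ** 8 - (h3 - h4) + h0' ** 48)%eqn.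
  have reg : regular (2 ^+ 3 * 3) by regularity.
  by apply: reg; rewrite /F1 /q1 /q2;
    lincomb ((h1 + h2) ** 16 - (h3 + h4) - h0 ** 30)%eqn.
have p0 := mn_jordan_commutator_perp x.
have p1 : perp F1 (x ⋅ x ⋅ x).
  by apply: (perp_absorb p0 (q := q1)) => y; case: (lin y).
move=> y; apply: sp => w.
have h := (lin y).2; have p0' := perp_sym p0 w; have p1' := perp_sym p1 w.
clear lin p0 p1; move: (T z ⋅ z - z ⋅ T z) (T x ⋅ x - x ⋅ T x) F1 q1 q2 h p0' p1'.
move=> F2 F0 F1' q1' q2' h p0' p1'.
by lincomb ((F2 ⋅ y ⋅ x ⋅ x ⋅ x ⋅ w) *> h
  - (F2 ⋅ y) *> (p1' <* (y ⋅ q1') + p0' <* (y ⋅ q2')))%eqn.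
Qed.

Lemma mn_jordan_left x : T (x ⋅ x) = T x ⋅ x.
Proof.
apply/eqP; rewrite -subr_eq0; apply/eqP; apply: regs.
by lincomb (Tsq x - mn_jordan_commuting x ** n)%eqn.
Qed.
End MNJordan.
End SemiprimeRing.

(** * From torsion-freeness to regular integers, and conclusion *)

Lemma torsion_free_regular (R : zmodType) (k d : nat) :
  torsion_free R k -> (d %| k)%N -> regular R (Posz d).
Proof.
move=> hk /dvdnP [q kE] x; rewrite -pmulrn => hx.
by apply: hk; rewrite kE mulnC mulrnA hx mul0rn.
Qed.

Theorem theorem1p6 (m n : nat) (R : zmodType) (mul : R -> R -> R) (T : R -> R) :
  (1 <= m)%N -> (1 <= n)%N ->
  assoc_ring_axioms mul ->
  torsion_free R (6 * m * n * (m + n) * (2 * n + m)) ->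
  semiprime mul ->
  generalized_mn_jordan_centralizer mul m n T ->
  (exists x, T x <> 0) ->
  two_sided_centralizer mul T.
Proof.
move=> _ _ HR tf sp [TD [T0 [[T0D T0sq] Tsq]]] _.
have reg d : (d %| 6 * m * n * (m + n) * (2 * n + m))%N -> regular R (Posz d).
  exact: torsion_free_regular.
have reg2 : regular R 2 by apply: (reg 2); rewrite -!mulnA dvdn_mulr.
have reg3 : regular R 3 by apply: (reg 3); rewrite -!mulnA dvdn_mulr.
have regm : regular R m%:Z by apply: reg; rewrite -!mulnA dvdn_mull // dvdn_mulr.
have regn : regular R n%:Z.
  by apply: reg; rewrite -!mulnA dvdn_mull // dvdn_mull // dvdn_mulr.
have regs : regular R (m%:Z + n%:Z).
  by rewrite -PoszD; apply: reg; rewrite dvdn_mulr // dvdn_mull.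
have rega : regular R (m%:Z + 2 * n%:Z).
  by rewrite addrC -PoszM -PoszD; apply: reg; rewrite dvdn_mull.
have T0sqz x : T0 (mul x x) *~ (m%:Z + n%:Z)
    = mul (T0 x) x *~ m%:Z + mul x (T0 x) *~ n%:Z.
  by rewrite -PoszD -!pmulrn T0sq.
have DD : additive_map (fun x => T x - T0 x).
  by move=> x y; rewrite TD T0D opprD addrACA.
have Dsq x : (T (mul x x) - T0 (mul x x)) *~ (m%:Z + n%:Z)
    = mul (T x - T0 x) x *~ m%:Z.
  have h1 : T (mul x x) *~ (m%:Z + n%:Z)
      = mul (T x) x *~ m%:Z + mul x (T0 x) *~ n%:Z.
    by rewrite -PoszD -!pmulrn Tsq.
  by lincomb (h1 - T0sqz x)%eqn.
have TE x : T x = T0 x.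
  apply/eqP; rewrite -subr_eq0; apply/eqP.
  exact: (defect_eq0 HR sp DD Dsq reg2 reg3 regm regn regs rega).
have left0 := mn_jordan_left HR sp T0D T0sqz reg2 reg3 regm regn regs rega.
have comm0 := mn_jordan_commuting HR sp T0D T0sqz reg2 reg3 regm regn regs rega.
split; split=> // x y; rewrite !TE.
  exact: (left_jordan_centralizer HR sp T0D left0 reg2).
have [mA mDl mDr] := HR.
(* Since [T0 u] commutes with [u], [T0] is also a left Jordan centralizer of the opposite ring,
   which gives the right-hand property. *)
have HR' : assoc_ring_axioms (fun u v => mul v u).
  by split=> [u v w|u v w|u v w]; rewrite ?mA ?mDl ?mDr.
have sp' : semiprime (fun u v => mul v u).
  by move=> u hu; apply: sp => r; rewrite -mA hu.
apply: (left_jordan_centralizer HR' sp' T0D _ reg2 y x) => u /=.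
by rewrite left0 comm0.
Qed.
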